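(* Let $n \geq 1$ be a natural number; in the case $n > 1$ assume the axiom of $\boldsymbol{\Sigma}^1_n$-determinacy. Then for every Polish space $\mathcal{X}$ there exists a continuous function $u^{\mathcal{X}}_n : \mathcal{N} \to \mathcal{N}$ such that for almost all $\alpha \in \mathcal{N}$ (i.e., for all $\alpha$ in a comeager subset of $\mathcal{N}$) the set \[ \mathrm{G}^{\mathcal{X}}_{n}(\alpha) \,\triangle\, \mathrm{U}^{\mathcal{X}}(u^{\mathcal{X}}_n(\alpha)) \] is a meager subset of $\mathcal{X}$.
   Context: Notation. $\omega = \{0,1,2,\dots\}$; $\mathcal{N} = \omega^\omega$ is the Baire space with the product topology. $\triangle$ denotes symmetric difference. For $P \subseteq X \times Y$ and $x \in X$, the section $\{y \in Y : (x,y)\in P\}$ is denoted $P_x$ or $P(x)$; we write $P(x,y)$ for $(x,y) \in P$. A Polish space is a (nonempty) separable completely metrizable topological space. Coding of finite sequences. For $n\ge 1$, $\langle u_0,\dots,u_{n-1}\rangle = p_0^{u_0+1}\cdots p_{n-1}^{u_{n-1}+1}$, where $p_0<p_1<\dots$ are the primes; $\langle \emptyset\rangle = 1$. If $s=\langle u_0,\dots,u_{n-1}\rangle$ and $i<n$, then $(s)_i := u_i$; if $i \ge n$ or $s$ is not in the image of $\langle\cdot\rangle$, then $(s)_i := 0$. Put $q_k = (k)_0/((k)_1+1)$, an enumeration of the non-negative rationals. Basic open sets. For every Polish space $\mathcal{X}$ (including products) a compatible metric $d_{\mathcal{X}}$ and a dense sequence $(r^{\mathcal{X}}_i)_{i\in\omega}$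 are fixed, and $N(\mathcal{X},s)$ is the open $d_{\mathcal{X}}$-ball with center $r^{\mathcal{X}}_{(s)_0}$ and radius $q_{(s)_1}$ (the empty set if the radius is $0$). For $\mathcal{N}$ the choice is: $d_{\mathcal{N}}(\alpha,\beta) = (n+1)^{-1}$ with $n$ least such that $\alpha(n)\neq\beta(n)$ if $\alpha \ne \beta$, $d_{\mathcal N}(\alpha,\alpha)=0$, and $r^{\mathcal{N}}_s(i) = (s)_i$. Universal sets. For every Polish space $\mathcal{X}$ define $\mathrm{U}^{\mathcal{X}}, \mathrm{F}^{\mathcal{X}}, \mathrm{G}^{\mathcal{X}}_n \subseteq \mathcal{N}\times\mathcal{X}$ ($n\ge 1$) by $\mathrm{U}^{\mathcal{X}}(\alpha,x) \iff (\exists n\in\omega)[x\in N(\mathcal{X},\alpha(n))]$; $\mathrm{F}^{\mathcal{X}}(\alpha,x)\iff \neg\,\mathrm{U}^{\mathcal{X}}(\alpha,x)$; $\mathrm{G}^{\mathcal{X}}_1(\alpha,x)\iff(\exists\gamma\in\mathcal{N})\,\mathrm{F}^{\mathcal{X}\times\mathcal{N}}(\alpha,x,\gamma)$; $\mathrm{G}^{\mathcal{X}}_{n+1}(\alpha,x)\iff(\exists\gamma\in\mathcal{N})\,\neg\,\mathrm{G}^{\mathcal{X}\times\mathcal{N}}_n(\alpha,x,\gamma)$. Thus $\mathrm{U}^{\mathcal{X}}$ is universal for the open subsets of $\mathcal{X}$ and $\mathrm{G}^{\mathcal{X}}_n$ is universal for the $\boldsymbol{\Sigma}^1_n$ subsets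 of $\mathcal{X}$. $\boldsymbol{\Sigma}^1_n$-determinacy is the statement that every two-player infinite game of perfect information on $\omega$ whose payoff set is a $\boldsymbol{\Sigma}^1_n$ subset of $\mathcal{N}$ is determined. *)

(* Defs.v *)
From HB Require Import structures.
From mathcomp Require Import all_boot all_order all_algebra.
From mathcomp Require Import all_classical reals topology.

Set Implicit Arguments.
Unset Strict Implicit.
Unset Printing Implicit Defensive.

Import Order.TTheory GRing.Theory Num.Theory.

Local Open Scope classical_set_scope.
Local Open Scope ring_scope.

Definition nowhere_dense (T : topologicalType) (A : set T) : Prop :=
  interior (closure A) = set0.

Definition meager (T : topologicalType) (A : set T) : Prop :=
  exists F : nat -> set T,
    (forall k, nowhere_dense (F k)) /\ A `<=` \bigcup_k F k.

Definition comeager (T : topologicalType) (A : set T) : Prop :=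
  meager (~` A).

Section Metrics.
Variable R : realType.

Record is_metric (T : Type) (d : T -> T -> R) : Prop := IsMetric {
  is_metric_eq0 : forall x y, d x y = 0 <-> x = y ;
  is_metric_sym : forall x y, d x y = d y x ;
  is_metric_triangle : forall x y z, d x z <= d x y + d y z }.

Definition compatible_metric (T : topologicalType) (d : T -> T -> R) : Prop :=
  is_metric d /\
  forall (x : T) (A : set T),
    nbhs x A <-> exists2 e : R, 0 < e & [set y | d x y < e] `<=` A.

Definition complete_metric (T : topologicalType) (d : T -> T -> R) : Prop :=
  forall u : nat -> T,
    (forall e : R, 0 < e -> exists N : nat, forall i j : nat,
        (N <= i)%N -> (N <= j)%N -> d (u i) (u j) < e) ->
    exists l : T, u @ \oo --> l.

End Metrics.

Section MetricFacts.
Variables (R : realType) (T : topologicalType) (d : T -> T -> R).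
Hypothesis dC : compatible_metric d.

Lemma metric_ge0 x y : 0 <= d x y.
Proof.
have [[d0 dS dT] _] := dC.
have := dT x y x; rewrite (dS y x) (d0 x x).2 //.
by rewrite -mulr2n pmulrn_lge0.
Qed.

Lemma metric_cvg (u : nat -> T) (l : T) :
  (forall e : R, 0 < e -> exists N : nat, forall i, (N <= i)%N -> d l (u i) < e) <->
  u @ \oo --> l.
Proof.
split=> [H A /dC.2 [e e0 eA]|H e e0].
  by have [N HN] := H e e0; exists N => // i /= Ni; apply/eA/HN.
have : nbhs l [set y | d l y < e] by apply/dC.2; exists e.
by move=> /H [N _ HN]; exists N => i Ni; exact: HN.
Qed.

End MetricFacts.

HB.mixin Record isPolish (R : realType) T & Topological T := {
  polish_nonempty : [set: T] !=set0 ;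
  polish_separable : exists2 D : set T, countable D & dense D ;
  polish_metrizable : exists2 d : T -> T -> R,
    compatible_metric d & complete_metric d }.

#[short(type="polishType")]
HB.structure Definition Polish (R : realType) :=
  { T of isPolish R T & Topological T }.


Section ProductPolish.
Variables (R : realType) (X Y : polishType R).

Let prod_dist (dX : X -> X -> R) (dY : Y -> Y -> R) (p q : X * Y) : R :=
  Num.max (dX p.1 q.1) (dY p.2 q.2).

Lemma prod_nonempty : [set: X * Y] !=set0.
Proof.
have [x _] := @polish_nonempty R X; have [y _] := @polish_nonempty R Y.
by exists (x, y).
Qed.

Lemma prod_separable : exists2 D : set (X * Y), countable D & dense D.
Proof.
have [D cD dD] := @polish_separable R X; have [E cE dE] := @polish_separable R Y.
exists (D `*` E); first exact: countableX.
move=> O [[x y] Oxy]; rewrite openE => /(_ _ Oxy) [[A B] /= [nA nB] ABO].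
have [] := dD A°; [by exists x | exact: open_interior |].
move=> x' [/interior_subset Ax' Dx'].
have [] := dE B°; [by exists y | exact: open_interior |].
move=> y' [/interior_subset By' Ey'].
by exists (x', y'); split => //; apply: ABO.
Qed.

Lemma prod_metrizable : exists2 d : X * Y -> X * Y -> R,
  compatible_metric d & complete_metric d.
Proof.
have [dX cX kX] := @polish_metrizable R X.
have [dY cY kY] := @polish_metrizable R Y.
have cd : compatible_metric (prod_dist dX dY).
  have [[dX0 dXS dXT] nX] := cX; have [[dY0 dYS dYT] nY] := cY.
  split; first split.
  - move=> [x y] [x' y']; rewrite /prod_dist /=; split=> [m0|[-> ->]].
      have := metric_ge0 cX x x'; have := metric_ge0 cY y y'.
      have : Num.max (dX x x') (dY y y') <= 0 by rewrite m0.
      rewrite ge_max => /andP[a b] c e.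
      by congr pair; [apply/dX0/le_anti; rewrite a e|apply/dY0/le_anti; rewrite b c].
    by rewrite (dX0 x' x').2 // (dY0 y' y').2 // maxxx.
  - by move=> p q; rewrite /prod_dist dXS dYS.
  - move=> p q r; rewrite /prod_dist ge_max; apply/andP; split.
      by apply: le_trans (dXT _ q.1 _) _; apply: lerD; rewrite le_max lexx.
    by apply: le_trans (dYT _ q.2 _) _; apply: lerD; rewrite le_max lexx orbT.
  move=> [x y] A; split.
    move=> [[B C] /= [/nX [e e0 eB] /nY [f f0 fC]] BCA].
    exists (Num.min e f); first by rewrite lt_min e0.
    move=> [x' y'] /=; rewrite /prod_dist gt_max !lt_min /=.
    by move=> /andP[/andP[ae _] /andP[_ bf]]; apply: BCA; split; [exact: eB|exact: fC].
  move=> [e e0 eA].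
  exists ([set x' | dX x x' < e], [set y' | dY y y' < e]) => /=.
    by split; [apply/nX|apply/nY]; exists e.
  by move=> [x' y'] /= [a b]; apply: eA; rewrite /= /prod_dist gt_max a b.
exists (prod_dist dX dY) => // u cu.
have [|l1 hl1] := kX (fun i => (u i).1).
  move=> e /cu [N HN]; exists N => i j Ni Nj; have := HN _ _ Ni Nj.
  by rewrite /prod_dist gt_max => /andP[].
have [|l2 hl2] := kY (fun i => (u i).2).
  move=> e /cu [N HN]; exists N => i j Ni Nj; have := HN _ _ Ni Nj.
  by rewrite /prod_dist gt_max => /andP[].
exists (l1, l2); apply/(metric_cvg cd) => e e0.
have [N1 H1] := (metric_cvg cX _ _).2 hl1 _ e0.
have [N2 H2] := (metric_cvg cY _ _).2 hl2 _ e0.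
exists (maxn N1 N2) => i; rewrite geq_max => /andP[a b].
by rewrite /prod_dist gt_max H1 // H2.
Qed.

HB.instance Definition _ := isPolish.Build R (X * Y)%type
  prod_nonempty prod_separable prod_metrizable.

End ProductPolish.

Lemma ex_prime_gt (m : nat) : exists p, (m < p)%N && prime p.
Proof. by have [p mp pp] := prime_above m; exists p; rewrite mp. Qed.

Fixpoint nth_prime (i : nat) : nat :=
  if i is j.+1 then ex_minn (ex_prime_gt (nth_prime j)) else 2%N.

Definition seq_code (u : seq nat) : nat :=
  (\prod_(i < size u) nth_prime i ^ (nth 0 u i).+1)%N.

(* Inverse of seq_code; the empty sequence outside the range of seq_code. *)
Definition seq_decode (s : nat) : seq nat :=
  xget [::] [set u | seq_code u = s].

Definition coord (s i : nat) : nat := nth 0%N (seq_decode s) i.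

Lemma prime_nth_prime i : prime (nth_prime i).
Proof. by case: i => //= i; case: ex_minnP => p /andP[]. Qed.

Lemma nth_prime_inj : injective nth_prime.
Proof.
have H i : (nth_prime i < nth_prime i.+1)%N.
  by rewrite /=; case: ex_minnP => p /andP[].
exact: (incn_inj (leq_mono (homo_ltn ltn_trans H))).
Qed.

Lemma seq_code_gt0 u : (0 < seq_code u)%N.
Proof. by apply: prodn_gt0 => i; rewrite expn_gt0 prime_gt0 ?prime_nth_prime. Qed.

Lemma logn_seq_code u i :
  logn (nth_prime i) (seq_code u) = if (i < size u)%N then (nth 0 u i).+1 else 0%N.
Proof.
have E (F : nat -> nat) n :
  logn (nth_prime i) (\prod_(k < n) nth_prime k ^ (F k).+1)%N =
  if (i < n)%N then (F i).+1 else 0%N.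
  elim: n => [|n IH]; first by rewrite big_ord0 logn1.
  rewrite big_ord_recr /= lognM; last 2 first.
  - by apply: prodn_gt0 => k; rewrite expn_gt0 prime_gt0 ?prime_nth_prime.
  - by rewrite expn_gt0 prime_gt0 ?prime_nth_prime.
  rewrite IH lognX logn_prime ?prime_nth_prime // (inj_eq nth_prime_inj).
  rewrite (ltnS i n) (leq_eqVlt i n).
  by case: (ltngtP i n) => //= [_|_|->]; rewrite ?muln0 ?addn0 ?muln1 ?add0n.
exact: (E (nth 0%N u)).
Qed.

Lemma seq_code_inj : injective seq_code.
Proof.
move=> u v uv.
have H i : (if (i < size u)%N then (nth 0 u i).+1 else 0%N) =
           (if (i < size v)%N then (nth 0 v i).+1 else 0%N).
  by rewrite -!logn_seq_code uv.
have S : size u = size v.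
  apply/eqP; rewrite eqn_leq; apply/andP; split; rewrite leqNgt; apply/negP.
    by move=> lt; have := H (size v); rewrite lt ltnn.
  by move=> lt; have := H (size u); rewrite lt ltnn.
apply: (@eq_from_nth _ 0%N) => // i iu; have := H i.
by rewrite -S iu => -[].
Qed.

Lemma seq_codeK : cancel seq_code seq_decode.
Proof.
move=> u; rewrite /seq_decode; case: xgetP => [v _ /seq_code_inj //|/(_ u)]; by case.
Qed.

(* The k-th non-negative rational, as an element of R. *)
Definition qrat (R : realType) (k : nat) : R :=
  (coord k 0)%:R / (coord k 1).+1%:R.

Definition baire : Type := prod_topology (fun _ : nat => nat).

HB.instance Definition _ :=
  Topological.copy baire (prod_topology (fun _ : nat => nat)).

Definition baire_seq (s : nat) : baire := fun i => coord s i.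

Lemma neq_baireP (a b : baire) : a <> b -> exists i, a i != b i.
Proof.
apply: contra_notP => /forallNP H; apply/funext => i.
by apply/eqP/negPn/negP/H.
Qed.

Section BairePolish.
Variable R : realType.

Definition baire_dist (a b : baire) : R :=
  if pselect (a = b) is right ab then (ex_minn (neq_baireP ab)).+1%:R^-1 else 0.

Lemma baire_dist_lt a b n :
  baire_dist a b < n.+1%:R^-1 <-> forall i, (i <= n)%N -> a i = b i.
Proof.
rewrite /baire_dist; case: pselect => [->|ab].
  by split=> // _; rewrite invr_gt0.
case: ex_minnP => m mab Hm.
rewrite ltf_pV2 ?posrE // ltr_nat ltnS; split=> [nm i il|H].
  apply/eqP/negPn/negP => /Hm; rewrite leqNgt.
  by rewrite (leq_ltn_trans il nm).
by rewrite ltnNge; apply/negP => /H E; rewrite E eqxx in mab.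
Qed.

Lemma baire_dist_neq a b : a <> b ->
  exists2 m, baire_dist a b = m.+1%:R^-1 & a m <> b m.
Proof.
move=> ab; rewrite /baire_dist; case: pselect => // ab'.
by case: ex_minnP => m /eqP mab Hm; exists m.
Qed.

Lemma baire_dist_ge0 a b : 0 <= baire_dist a b.
Proof. by rewrite /baire_dist; case: pselect => // ab; rewrite invr_ge0. Qed.

Lemma baire_dist_metric : is_metric baire_dist.
Proof.
have S a b : baire_dist a b <= baire_dist b a.
  have [->//|/baire_dist_neq [m E ne]] := pselect (b = a).
  rewrite E leNgt; apply/negP.
  have [->|/baire_dist_neq [k Ek nek]] := pselect (a = b).
    by rewrite /baire_dist; case: pselect => // _; rewrite ltNge invr_ge0 ler0n.
  rewrite Ek => lt.
  have : baire_dist b a < k.+1%:R^-1 by rewrite E.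
  by move/baire_dist_lt => /(_ k (leqnn _)) /esym.
split=> [a b|a b|a b c].
- split=> [|->]; last by rewrite /baire_dist; case: pselect.
  have [//|/baire_dist_neq [m -> _]] := pselect (a = b).
  by move=> /eqP; rewrite invr_eq0 pnatr_eq0.
- by apply/le_anti; rewrite !S.
- have [->|/baire_dist_neq [m E ne]] := pselect (a = c).
    rewrite {1}/baire_dist; case: pselect => // _.
    by rewrite addr_ge0 ?baire_dist_ge0.
  rewrite E leNgt; apply/negP => lt.
  have ab : baire_dist a b < m.+1%:R^-1.
    by apply: le_lt_trans lt; rewrite lerDl baire_dist_ge0.
  have bc : baire_dist b c < m.+1%:R^-1.
    by apply: le_lt_trans lt; rewrite lerDr baire_dist_ge0.
  apply: ne; move/baire_dist_lt: ab => /(_ m (leqnn _)) ->.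
  by move/baire_dist_lt: bc => /(_ m (leqnn _)) ->.
Qed.

Lemma baire_dist_compatible : compatible_metric baire_dist.
Proof.
split; first exact: baire_dist_metric.
move=> x A; split=> [nA|[e e0 eA]].
  pose F : set_system baire := filter_from [set: nat]
    (fun n => [set y | forall i, (i <= n)%N -> x i = y i]).
  have FF : Filter F.
    apply: filter_from_filter; first by exists 0%N.
    move=> m n _ _; exists (maxn m n) => // y H; split=> i il; apply: H.
      by rewrite leq_max il.
    by rewrite leq_max il orbT.
  have : F --> x.
    apply/cvg_sup => i U [V [[W oW <-] Wx] WU].
    exists i => // y H; apply: WU => /=.
    by rewrite /= -(H i (leqnn _)).
  move=> /(_ A nA) [n _ nsub]; exists (n.+1%:R^-1); first by rewrite invr_gt0.
  by move=> y /= /baire_dist_lt; apply: nsub.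
have [n ne] : exists n : nat, n.+1%:R^-1 < e.
  exists (Num.bound e^-1); rewrite invf_plt ?posrE //.
  apply: lt_trans (archi_boundP _) _; first by rewrite invr_ge0 ltW.
  by rewrite ltr_nat.
apply: filterS (eA) _.
apply: (@filterS _ _ _ [set y : baire | forall i, (i < n.+1)%N -> x i = y i]).
  by move=> y H /=; apply: lt_trans ne; apply/baire_dist_lt.
elim: n.+1 => [|k IH]; first by apply: filterS filterT.
have nk : nbhs x [set y : baire | x k = y k].
  have := @proj_continuous nat (fun _ => nat) k x [set j | x k = j].
  by apply; rewrite nbhs_principalE; apply/principal_filterP.
apply: filterS (filterI IH nk) => y [H E] i.
by rewrite ltnS leq_eqVlt => /orP[/eqP ->|/H].
Qed.

Lemma baire_dist_complete : complete_metric baire_dist.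
Proof.
move=> u cu.
have H n : exists N, forall i j, (N <= i)%N -> (N <= j)%N ->
    forall k, (k <= n)%N -> u i k = u j k.
  have [|N HN] := cu n.+1%:R^-1; first by rewrite invr_gt0.
  by exists N => i j Ni Nj; apply/baire_dist_lt/HN.
pose f n := projT1 (cid (H n)).
have fP n := projT2 (cid (H n)).
exists (fun n => u (f n) n); apply/(metric_cvg baire_dist_compatible) => e e0.
have [n ne] : exists n : nat, n.+1%:R^-1 < e.
  exists (Num.bound e^-1); rewrite invf_plt ?posrE //.
  apply: lt_trans (archi_boundP _) _; first by rewrite invr_ge0 ltW.
  by rewrite ltr_nat.
exists (f n) => i ni; apply: lt_trans ne; apply/baire_dist_lt => k kn.
rewrite (fP k _ (maxn (f k) (f n))) ?leq_maxl //.
by apply: (fP n) => //; exact: leq_maxr.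
Qed.

Lemma baire_seq_dense : dense (range baire_seq).
Proof.
move=> O [x Ox]; rewrite openE => /(_ _ Ox) /baire_dist_compatible.2 [e e0 eO].
have [n ne] : exists n : nat, n.+1%:R^-1 < e.
  exists (Num.bound e^-1); rewrite invf_plt ?posrE //.
  apply: lt_trans (archi_boundP _) _; first by rewrite invr_ge0 ltW.
  by rewrite ltr_nat.
exists (baire_seq (seq_code (mkseq x n.+1))); split; last by eexists.
apply: eO; apply: lt_trans ne; apply/baire_dist_lt => i il.
by rewrite /baire_seq /coord seq_codeK nth_mkseq.
Qed.

Lemma baire_nonempty : [set: baire] !=set0.
Proof. by exists (fun _ => 0%N). Qed.

Lemma baire_separable : exists2 D : set baire, countable D & dense D.
Proof.
exists (range baire_seq); last exact: baire_seq_dense.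
exact: sub_countable (card_image_le _ _) (countableP _).
Qed.

Lemma baire_metrizable : exists2 d : baire -> baire -> R,
  compatible_metric d & complete_metric d.
Proof.
by exists baire_dist; [exact: baire_dist_compatible|exact: baire_dist_complete].
Qed.

End BairePolish.

HB.instance Definition _ (R : realType) := isPolish.Build R baire
  baire_nonempty (baire_separable R) (baire_metrizable R).

Section Codes.
Variable R : realType.

Record presentation (X : topologicalType) : Type := Presentation {
  pdist : X -> X -> R ;
  pseq : nat -> X ;
  pdist_compatible : compatible_metric pdist ;
  pseq_dense : dense (range pseq) }.

Definition baire_presentation : presentation baire :=
  Presentation (baire_dist_compatible R) (baire_seq_dense R).

(* A choice of a compatible metric and a dense sequence for every Polish space,
   prescribed on the Baire space and arbitrary elsewhere; in particular the data
   on a product need not be related to those on the factors. *)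
Record polish_choice : Type := PolishChoice {
  pres : forall X : polishType R, presentation X ;
  pres_baire : pres baire = baire_presentation }.

Lemma polish_presentation (X : polishType R) : exists p : presentation X, True.
Proof.
have [x0 _] := @polish_nonempty R X.
have [D cD dD] := @polish_separable R X.
have [d cd _] := @polish_metrizable R X.
have D0 : D !=set0.
  have [|y [_ Dy]] := dD setT _ (@openT X); first by exists x0.
  by exists y.
have [f fD] : exists f : nat -> X, D `<=` range f.
  have /countable_injP [g gi] := cD.
  exists (fun n => xget x0 [set y | D y /\ g y = n]) => y Dy.
  exists (g y) => //; case: xgetP => [z _ [Dz gz]|H]; last by case: (H y).
  by apply: gi gz; rewrite inE.
have df : dense (range f).
  by move=> O O0 oO; have [y [Oy Dy]] := dD O O0 oO; exists y; split => //; exact: fD.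
by exists (Presentation cd df).
Qed.

Lemma polish_choice_inhabited : inhabited polish_choice.
Proof.
pose P (X : polishType R) (p : presentation X) :=
  forall e : (baire : polishType R) = X,
    p = eq_rect _ (fun Y : polishType R => presentation Y) baire_presentation _ e.
have H X : exists p, @P X p.
  have [e|ne] := pselect ((baire : polishType R) = X).
    exists (eq_rect _ (fun Y : polishType R => presentation Y) baire_presentation _ e) => e'.
    by rewrite (Prop_irrelevance e e').
  by have [p _] := polish_presentation X; exists p => e; case: (ne e).
exists; exists (fun X => projT1 (cid (H X))).
exact: (projT2 (cid (H baire)) erefl).
Qed.

Variable c : polish_choice.

Definition basic_open (X : polishType R) (s : nat) : set X :=
  [set x | pdist (pres c X) (pseq (pres c X) (coord s 0)) x
           < qrat R (coord s 1)].

Arguments basic_open : clear implicits.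

Definition univ_U (X : polishType R) (a : baire) : set X :=
  [set x | exists n : nat, basic_open X (a n) x].

Arguments univ_U : clear implicits.

(* Level 0 is univ_U, so that level 1 projects the universal closed set
   ~` univ_U and all higher levels follow the same recursion. *)
Fixpoint univ_G (n : nat) (X : polishType R) (a : baire) : set X :=
  if n is m.+1 then
    [set x | exists g : baire, (~` @univ_G m (X * baire)%type a) (x, g)]
  else univ_U X a.

End Codes.

Arguments basic_open {R} c X s _.
Arguments univ_U {R} c X a _.
Arguments univ_G {R} c n X a _.

(* Boldface Sigma^1_n for n >= 1 (level 0 means open): Sigma^1_1 sets are the
   projections along the Baire space of closed sets, and Sigma^1_(n+1) sets the
   projections of complements of Sigma^1_n sets. *)
Fixpoint Sigma1 (n : nat) (X : topologicalType) (A : set X) : Prop :=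
  if n is m.+1 then
    exists2 B : set (X * baire),
      @Sigma1 m (X * baire)%type (~` B) &
      A = [set x | exists g : baire, B (x, g)]
  else open A.

(* A strategy maps each position to the next move; player I moves at even
   positions, player II at odd ones, and I wins the run a iff a is in the payoff
   set. *)
Definition strategy : Type := seq nat -> nat.

Definition follows_I (s : strategy) (a : baire) : Prop :=
  forall k : nat, a k.*2 = s (mkseq a k.*2).

Definition follows_II (s : strategy) (a : baire) : Prop :=
  forall k : nat, a k.*2.+1 = s (mkseq a k.*2.+1).

Definition determined (A : set baire) : Prop :=
  (exists s : strategy, forall a, follows_I s a -> A a) \/
  (exists s : strategy, forall a, follows_II s a -> ~ A a).

Definition Sigma1_determinacy (n : nat) : Prop :=
  forall A : set baire, Sigma1 n A -> determined A.

(* Main.v *)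
(* By Kuratowski-Ulam it suffices that the universal set G_n, a subset of N x X,
   differs from some open W by a meager set: almost all sections then satisfy
   the same, and W is a countable union of boxes (clopen cylinder) x (basic ball),
   so a code of the section W_a depends continuously on a.

   The Baire property of G_n comes from the unfolded Banach-Mazur game. G_n is the
   projection of a set B whose complement is Sigma^1_(n-1); the players choose
   shrinking balls converging to a point x while player I also builds g, and
   player I wins iff (x, g) is in B. If player I has a winning strategy, G_n is
   comeager in some nonempty open set; if player II has one, G_n is meager. For
   n = 1 the payoff is closed, so Gale-Stewart applies; for n > 1 it is
   Pi^1_(n-1), hence Sigma^1_n. *)
Require Import Defs.
From mathcomp Require Import all_boot all_order all_algebra.
From mathcomp Require Import all_classical reals topology.

Set Implicit Arguments.
Unset Strict Implicit.
Unset Printing Implicit Defensive.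

Import Defs Order.TTheory GRing.Theory Num.Theory.

Local Open Scope classical_set_scope.
Local Open Scope ring_scope.

(** * Cylinders of the Baire space and continuity into it *)

Lemma eq_mkseqP (a b : nat -> nat) n :
  mkseq a n = mkseq b n <-> forall i, (i < n)%N -> a i = b i.
Proof.
split=> [ab i ni|ab]; first by rewrite -(nth_mkseq 0%N a ni) ab nth_mkseq.
apply: (@eq_from_nth _ 0%N); rewrite !size_mkseq // => i ni.
by rewrite !nth_mkseq // ab.
Qed.

Lemma exists_invn_lt (R : realType) (e : R) : 0 < e -> exists n : nat, n.+1%:R^-1 < e.
Proof.
move=> e0; exists (Num.bound e^-1); rewrite invf_plt ?posrE //.
apply: lt_trans (archi_boundP _) _; first by rewrite invr_ge0 ltW.
by rewrite ltr_nat.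
Qed.

Lemma nbhs_baireP (R : realType) (a : baire) (A : set baire) :
  nbhs a A <-> exists n, [set b : baire | mkseq b n = mkseq a n] `<=` A.
Proof.
split=> [/(baire_dist_compatible R).2 [e e0 eA]|[n nA]].
  have [n ne] := exists_invn_lt e0; exists n.+1 => b /eq_mkseqP ab.
  by apply: eA; apply: lt_trans ne; apply/baire_dist_lt => i; rewrite -ltnS => /ab.
apply/(baire_dist_compatible R).2; exists n.+1%:R^-1; first by rewrite invr_gt0.
by move=> b /baire_dist_lt ab; apply/nA/eq_mkseqP => i /ltnW /ab.
Qed.

Lemma continuous_to_baire (R : realType) (T : topologicalType) (f : T -> baire) :
  (forall k x, \forall y \near x, f y k = f x k) -> continuous f.
Proof.
move=> fE x A /(nbhs_baireP R) [n nA].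
apply: (@filterS _ _ _ [set y | mkseq (f y) n = mkseq (f x) n]).
  by move=> y; exact: nA.
elim: n {nA} => [|n IHn]; first exact: filterE.
by apply: filterS2 IHn (fE n x) => y /= En yn; rewrite !mkseqS En yn.
Qed.

Lemma near_baire_coord (R : realType) (a : baire) k : \forall b \near a, b k = a k.
Proof. by apply/(nbhs_baireP R); exists k.+1 => b /eq_mkseqP; apply. Qed.

(** * Nowhere dense and meager sets *)

Lemma meagerS (T : topologicalType) (A B : set T) : A `<=` B -> meager B -> meager A.
Proof. by move=> AB [F [F0 BF]]; exists F; split => // x /AB /BF. Qed.

Lemma nowhere_denseP (T : topologicalType) (A : set T) :
  (forall U, open U -> U !=set0 ->
     exists V, [/\ open V, V !=set0, V `<=` U & V `&` A = set0]) ->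
  nowhere_dense A.
Proof.
move=> H; apply/eqP/negPn/negP => /set0P ne.
have [V [oV [x Vx] VA VA0]] := H _ (@open_interior _ _) ne.
have [y [Ay Vy]] : A `&` V !=set0.
  by apply: (interior_subset (VA _ Vx)); exact: open_nbhs_nbhs.
by have : (V `&` A) y by []; rewrite VA0.
Qed.

Lemma nowhere_dense0 (T : topologicalType) : nowhere_dense (set0 : set T).
Proof. by rewrite /nowhere_dense closure0 interior0. Qed.

Lemma nowhere_dense_meager (T : topologicalType) (A : set T) :
  nowhere_dense A -> meager A.
Proof. by move=> A0; exists (fun=> A); split => // x Ax; exists 0%N. Qed.

Lemma meager_bigcup (T : topologicalType) (I : countType) (F : I -> set T) :
  (forall i, meager (F i)) -> meager (\bigcup_i F i).
Proof.
move=> /choice [G GP].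
exists (fun n => if unpickle n is Some (i, k) then G i k else set0); split.
  move=> n; case: unpickle => [[i k]|]; first exact: (GP i).1.
  exact: nowhere_dense0.
move=> x [i _ /(GP i).2 [k _ Gx]]; exists (pickle (i, k)) => //.
by rewrite pickleK.
Qed.

Lemma meagerU (T : topologicalType) (A B : set T) :
  meager A -> meager B -> meager (A `|` B).
Proof.
move=> A0 B0; apply: (@meagerS _ _ (\bigcup_(b : bool) if b then A else B)).
  by move=> x [Ax|Bx]; [exists true|exists false].
by apply: meager_bigcup => -[].
Qed.

(** * Continuous maps on products and the projective classes *)

Lemma continuous_fst (T U : topologicalType) : continuous (@fst T U).
Proof. by move=> x; exact: cvg_fst. Qed.

Lemma continuous_snd (T U : topologicalType) : continuous (@snd T U).
Proof. by move=> x; exact: cvg_snd. Qed.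

Lemma continuous_pair (T U V : topologicalType) (f : T -> U) (g : T -> V) :
  continuous f -> continuous g -> continuous (fun x => (f x, g x)).
Proof. by move=> cf cg x; exact: (cvg_pair (cf x) (cg x)). Qed.

Lemma continuous_compose (T U V : topologicalType) (f : T -> U) (g : U -> V) :
  continuous f -> continuous g -> continuous (g \o f).
Proof. by move=> cf cg x; exact: (continuous_comp (cf x) (cg (f x))). Qed.

(** The witness coordinate is left untouched: take the preimage of [B] under [f] times the identity
    and recurse on its complement. *)
Lemma Sigma1_preimage n (X Y : topologicalType) (f : X -> Y) (A : set Y) :
  continuous f -> Sigma1 n A -> Sigma1 n (f @^-1` A).
Proof.
elim: n X Y f A => [|n IHn] X Y f A cf /=; first by move/continuousP: cf; apply.
move=> [B SB ->]; exists ((fun p => (f p.1, p.2)) @^-1` B) => //.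
rewrite preimage_setC; apply: IHn SB.
apply: continuous_pair; last exact: continuous_snd.
by apply: continuous_compose cf; exact: continuous_fst.
Qed.

(** Projects along a dummy coordinate; this lets determinacy at level [n.+1] apply to complements of
    level [n]. *)
Lemma Sigma1_setC n (X : topologicalType) (A : set X) :
  Sigma1 n (~` A) -> Sigma1 n.+1 A.
Proof.
move=> SA; exists (fst @^-1` A).
  by rewrite preimage_setC; apply: Sigma1_preimage SA; exact: continuous_fst.
by apply/seteqP; split=> x => [Ax|[]//]; exists (fun=> 0%N).
Qed.

(** * Basic balls and the complexity of the universal sets *)

Lemma open_basic_open (R : realType) (c : polish_choice R) (X : polishType R) s :
  open (basic_open c X s).
Proof.
rewrite openE => x; rewrite /basic_open /=; set p := pres c X => xs.
have [[_ dS dT] dn] := pdist_compatible p.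
apply/dn; exists (qrat R (coord s 1) - pdist p (pseq p (coord s 0)) x).
  by rewrite subr_gt0.
by move=> y /=; rewrite ltrBrDl; exact: le_lt_trans.
Qed.

Lemma basic_open_base (R : realType) (c : polish_choice R) (X : polishType R)
    (x : X) (A : set X) :
  nbhs x A -> exists2 s, basic_open c X s x & basic_open c X s `<=` A.
Proof.
have pC := pdist_compatible (pres c X); have [[d0 dS dT] dn] := pC.
move=> /dn [e e0 eA].
have [n ne] := exists_invn_lt (divr_gt0 e0 (ltr0n R 2)).
have nx : nbhs x [set y | pdist (pres c X) x y < n.+1%:R^-1].
  by apply/dn; exists n.+1%:R^-1; rewrite // invr_gt0.
have nx0 : [set y | pdist (pres c X) x y < n.+1%:R^-1]^° !=set0 by exists x.
have [z [zx [i _ iz]]] := pseq_dense (pres c X) nx0 (@open_interior _ _).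
have /= xi := interior_subset zx; rewrite -{z zx}iz in xi.
(* The inner code [[:: 1; n]] gives the radius 1/(n+1), the outer one the center, the [i]-th dense
   point. *)
have sE : qrat R (coord (seq_code [:: i; seq_code [:: 1%N; n]]) 1) = n.+1%:R^-1.
  by rewrite /qrat /coord !seq_codeK /= div1r.
exists (seq_code [:: i; seq_code [:: 1%N; n]]).
  by rewrite /basic_open /= sE /coord seq_codeK /= dS.
move=> y; rewrite /basic_open /= sE /coord seq_codeK /= => iy; apply: eA.
rewrite /= (splitr e); apply: le_lt_trans (dT _ (pseq (pres c X) i) _) _.
by apply: ltrD; exact: lt_trans ne.
Qed.

(** The code is kept as a coordinate, so that the Baire property can be proved for the whole
    universal set and not just for single sections. *)
Lemma Sigma1_univ_G (R : realType) (c : polish_choice R) n (X : polishType R) :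
  Sigma1 n [set p : baire * X | univ_G c n X p.1 p.2].
Proof.
elim: n X => [|n IHn] X.
  rewrite /= openE => -[a x] /= [k xk].
  exists ([set b | b k = a k], basic_open c X (a k)); last first.
    by move=> [b y] /= [bk yk]; exists k; rewrite bk.
  split; first exact: (near_baire_coord R).
  by apply: open_nbhs_nbhs; split => //; exact: open_basic_open.
exists ((fun q => (q.1.1, (q.1.2, q.2))) @^-1`
         ~` [set p : baire * (X * baire) | univ_G c n (X * baire)%type p.1 p.2]).
  rewrite preimage_setC setCK; apply: Sigma1_preimage (IHn _).
  have c12 : continuous (fst \o fst : baire * X * baire -> baire).
    by apply: continuous_compose; exact: continuous_fst.
  have c13 : continuous (snd \o fst : baire * X * baire -> X).
    by apply: continuous_compose; [exact: continuous_fst|exact: continuous_snd].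
  apply: continuous_pair c12 _; apply: continuous_pair c13 _.
  exact: continuous_snd.
by [].
Qed.

(** * Determinacy of closed games (Gale-Stewart) *)

(** If II cannot win from the start, I can always keep to positions not won by II. A run outside the
    closed set [C] would have a prefix with no extension in [C], and from there II wins with any
    strategy. *)
Lemma closed_determined (R : realType) (C : set baire) : closed C -> determined C.
Proof.
move=> cC.
pose win (s : seq nat) := exists t : strategy, forall a : baire,
  mkseq a (size s) = s ->
  (forall k, (size s <= k.*2.+1)%N -> a k.*2.+1 = t (mkseq a k.*2.+1)) -> ~ C a.
have winI s : ~~ odd (size s) -> (forall j, win (rcons s j)) -> win s.
  (* The strategies for the various moves [j] are glued: the move actually made is read off the
     history [p]. *)
  move=> se /choice [t tP]; exists (fun p => t (nth 0%N p (size s)) p) => a sa ta.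
  apply: (tP (a (size s)) a); rewrite size_rcons ?mkseqS ?sa // => k sk.
  by rewrite ta 1?ltnW // nth_mkseq.
have winII s j : odd (size s) -> win (rcons s j) -> win s.
  move=> so [t tP]; exists (fun p => if p == s then j else t p) => a sa ta.
  have aj : a (size s) = j.
    have sE : size s = (size s)./2.*2.+1 by rewrite -[LHS]odd_double_half so.
    by rewrite sE ta -?sE // sa eqxx.
  apply: (tP a); rewrite size_rcons ?mkseqS ?sa ?aj // => k sk.
  rewrite ta 1?ltnW //; case: eqP => // ks.
  by move: sk; rewrite -ks size_mkseq ltnn.
have [[t tP]|nwin] := pselect (win [::]); [right|left].
  by exists t => a at_; apply: (tP a) => // k _; exact: at_.
have /choice [t tP] : forall s, exists j,
    ~~ odd (size s) -> ~ win s -> ~ win (rcons s j).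
  move=> s; have [se|] := boolP (odd (size s)); first by exists 0%N.
  move=> se; have [ws|/(contra_not (winI s se))] := pselect (win s).
    by exists 0%N.
  by move=> /existsNP [j wj]; exists j.
exists t => a at_.
have nwa n : ~ win (mkseq a n).
  elim: n => [//|n IHn]; rewrite mkseqS.
  have [on|en] := boolP (odd n); first by move/winII; rewrite size_mkseq => /(_ on).
  have -> : a n = t (mkseq a n).
    have nE : n = n./2.*2 by rewrite -[LHS]odd_double_half (negbTE en).
    by rewrite nE.
  by apply: tP; rewrite ?size_mkseq.
apply: contrapT => nCa.
have : nbhs a (~` C) by apply: open_nbhs_nbhs; split => //; exact: closed_openC.
move=> /(nbhs_baireP R) [n nC]; apply: (nwa n).
by exists (fun=> 0%N) => b; rewrite size_mkseq => /nC.
Qed.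

(** * The unfolded Banach-Mazur game *)

Lemma strategy_run (h : strategy) : exists a : baire, forall n, a n = h (mkseq a n).
Proof.
pose s := fix s n := if n is m.+1 then rcons (s m) (h (s m)) else [::].
have E n : mkseq (fun n => h (s n)) n = s n.
  by elim: n => // n IHn; rewrite mkseqS IHn.
by exists (fun n => h (s n)) => n; rewrite E.
Qed.

Section BanachMazur.
Variables (R : realType) (c : polish_choice R) (Y : polishType R).
Variables (d : Y -> Y -> R).
Hypotheses (dC : compatible_metric d) (dK : complete_metric d).

Let N := basic_open c Y.

(** Closures keep limits inside and small diameters make runs Cauchy. Diameters are taken in the
    complete metric [d]; the metric behind [basic_open] is only known to be compatible. *)
Definition legal (V : set Y) (n k : nat) : Prop :=
  [/\ N k !=set0, closure (N k) `<=` V &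
      forall x y, N k x -> N k y -> d x y < n.+1%:R^-1].

Lemma legal_exists (V : set Y) n x : open V -> V x -> exists2 k, legal V n k & N k x.
Proof.
move=> oV Vx; have [[d0 dS dT] dn] := dC.
have /dn [e e0 eV] : nbhs x V by exact: open_nbhs_nbhs.
(* Half of [e] keeps the closure inside [V]; half of 1/(n+1) bounds the diameter. *)
pose f := Num.min (e / 2) (n.+1%:R^-1 / 2).
have f0 : 0 < f by rewrite lt_min !divr_gt0 ?invr_gt0 ?ltr0n.
have /(basic_open_base c) [k xk kf] : nbhs x [set y | d x y < f] by apply/dn; exists f.
exists k => //; split; first by exists x.
  move=> y /(_ [set z | d y z < e / 2]) [].
    by apply/dn; exists (e / 2); rewrite // divr_gt0.
  move=> z [/kf /= xz yz]; apply: eV; rewrite /= (splitr e).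
  apply: le_lt_trans (dT _ z _) _; rewrite (dS z); apply: ltrD => //.
  by move: xz; rewrite lt_min => /andP[].
move=> y z /kf /= xy /kf /= xz; rewrite (splitr n.+1%:R^-1).
move: xy xz; rewrite !lt_min => /andP[_ xy] /andP[_ xz].
by apply: le_lt_trans (dT _ x _) _; rewrite (dS y); exact: ltrD.
Qed.

(* Illegal moves are replaced by legal ones, so that every sequence of moves is a run. *)
Definition refine (V : set Y) (n k : nat) : set Y :=
  if `[< legal V n k >] then N k else N (xget 0%N [set j | legal V n j]).

Lemma refine_legal V n k : legal V n k -> refine V n k = N k.
Proof. by rewrite /refine => /asboolP ->. Qed.

Lemma refineP V n k : open V -> V !=set0 ->
  exists2 j, legal V n j & refine V n k = N j.
Proof.
move=> oV [x Vx]; rewrite /refine; case: asboolP => [kl|_]; first by exists k.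
exists (xget 0%N [set j | legal V n j]) => //; case: xgetP => [_ -> //|].
by have [j jl _] := legal_exists n oV Vx; move=> /(_ j).
Qed.

Variable O : set Y.
Hypotheses (oO : open O) (O0 : O !=set0).

(* A move codes a pair whose first coordinate is a basic open set; the second one
   is used by player I to build a witness. *)
Definition position (s : seq nat) : set Y :=
  (fix pos s := if s is k :: s' then refine (pos s') (size s') (coord k 0) else O)
    (rev s).

Lemma position_rcons s k :
  position (rcons s k) = refine (position s) (size s) (coord k 0).
Proof. by rewrite /position rev_rcons size_rev. Qed.

Lemma position_open s : open (position s) /\ position s !=set0.
Proof.
elim/last_ind: s => [//|s k [os s0]]; rewrite position_rcons.
have [j [j0 _ _] ->] := refineP (size s) (coord k 0) os s0.
by split => //; exact: open_basic_open.
Qed.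

Lemma position_rconsP s k : exists2 j, legal (position s) (size s) j &
  position (rcons s k) = N j.
Proof.
by rewrite position_rcons; have [] := position_open s; exact: refineP.
Qed.

Lemma position_rcons_sub s k : position (rcons s k) `<=` position s.
Proof.
have [j [_ js _] ->] := position_rconsP s k.
by apply: subset_trans js; exact: subset_closure.
Qed.

Lemma position_mkseq_sub (a : nat -> nat) m n : (m <= n)%N ->
  position (mkseq a n) `<=` position (mkseq a m).
Proof.
elim: n => [|n IHn]; first by rewrite leqn0 => /eqP ->.
rewrite leq_eqVlt => /orP[/eqP -> //|/IHn]; rewrite mkseqS.
by apply: subset_trans; exact: position_rcons_sub.
Qed.

Lemma position_outcome_exists (a : nat -> nat) :
  exists x, forall n, position (mkseq a n) x.
Proof.
have /choice [u uP] : forall n, exists x, position (mkseq a n.+1) x.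
  by move=> n; have [_] := position_open (mkseq a n.+1).
have uS m i : (m <= i)%N -> position (mkseq a m.+1) (u i).
  by move=> mi; exact: position_mkseq_sub (uP i).
have [|x ux] := dK (u := u).
  move=> e /exists_invn_lt [n ne]; exists n => i j /uS + /uS.
  rewrite mkseqS; have [k [_ _ kd] ->] := position_rconsP (mkseq a n) (a n).
  by move: kd; rewrite size_mkseq => kd ni nj; exact: lt_trans (kd _ _ ni nj) ne.
exists x => n.
have [k [_ ks _] kE] := position_rconsP (mkseq a n) (a n).
(* The limit is only known to lie in the closure of stage [n.+1], which legality puts inside stage
   [n]. *)
apply: ks => A /ux [m _ mA]; exists (u (maxn m n)); split.
  by rewrite -kE -mkseqS; apply: uS; exact: leq_maxr.
by apply: mA => /=; exact: leq_maxl.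
Qed.

Lemma position_outcome_close (a : nat -> nat) n x y :
  position (mkseq a n.+1) x -> position (mkseq a n.+1) y -> d x y < n.+1%:R^-1.
Proof.
rewrite mkseqS; have [k [_ _ kd] ->] := position_rconsP (mkseq a n) (a n).
by move: kd; rewrite size_mkseq; apply.
Qed.

Lemma position_outcome_unique (a : nat -> nat) x y :
  (forall n, position (mkseq a n) x) -> (forall n, position (mkseq a n) y) -> x = y.
Proof.
move=> ax ay; have [[d0 _ _] _] := dC.
apply/d0/eqP; rewrite eq_le (metric_ge0 dC) andbT leNgt; apply/negP.
move=> /exists_invn_lt [n]; apply/negP; rewrite -leNgt ltW //.
exact: position_outcome_close.
Qed.

Lemma continuous_outcome : exists2 f : baire -> Y, continuous f &
  forall a n, position (mkseq a n) (f a).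
Proof.
have /choice [f fP] := position_outcome_exists.
exists f => // a A /dC.2 [e e0 eA]; have [n ne] := exists_invn_lt e0.
apply/(nbhs_baireP R); exists n.+1 => b ab; apply: eA.
by apply: lt_trans (position_outcome_close (fP a _) _) ne; rewrite -ab.
Qed.

Definition reply (r : strategy) (s : seq nat) (k : nat) : seq nat :=
  rcons (rcons s k) (r (rcons s k)).

(** The points lost when the opponent of [r] has to play the digit [m] at [s], whatever ball it
    picks. These sets make up the exceptional meager set, whichever player [r] belongs to. *)
Definition escape (r : strategy) (s : seq nat) (m : nat) : set Y :=
  [set x | position s x /\
     forall j, ~ position (reply r s (seq_code [:: j; m])) x].

(** Inside any open set meeting [position s] the opponent can play a ball; the answer of [r] is a
    nonempty open subset of it, and none of its points escape. *)
Lemma nowhere_dense_escape r s m : nowhere_dense (escape r s m).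
Proof.
apply: nowhere_denseP => U oU U0; have [os s0] := position_open s.
have [[x [Ux sx]]|Us] := pselect ((U `&` position s) !=set0); last first.
  exists U; split => //; apply/seteqP; split=> // x [Ux [sx _]].
  by case: Us; exists x.
have [j [j0 jU jd] _] := legal_exists (size s) (openI oU os) (conj Ux sx).
have jE : position (rcons s (seq_code [:: j; m])) = N j.
  rewrite position_rcons /coord seq_codeK; apply: refine_legal.
  by split => //; apply: subset_trans jU _; exact: subIsetr.
have [oV V0] := position_open (reply r s (seq_code [:: j; m])).
exists (position (reply r s (seq_code [:: j; m]))); split => //.
  apply: subset_trans (@position_rcons_sub _ _) _; rewrite jE.
  apply: subset_trans (@subset_closure _ _) _.
  by apply: subset_trans jU _; exact: subIsetl.
by apply/seteqP; split => // y [yV [_ /(_ j)]].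
Qed.

(* As [x] never escapes, the opponent of [r] can always choose a ball such that
   the reply of [r] still contains [x], whatever witness digit [y k] it plays. *)
Lemma run_to_point (r : strategy) (s : seq nat) (x : Y) (y : nat -> nat) :
  position s x -> (forall t m, ~ escape r t m x) ->
  exists a : baire, [/\ mkseq a (size s) = s,
    forall k, coord (a (size s + k.*2)%N) 1 = y k,
    forall k, a (size s + k.*2).+1 = r (mkseq a (size s + k.*2).+1) &
    forall n, position (mkseq a n) x].
Proof.
move=> sx nesc.
have /choice [g gP] : forall tm : seq nat * nat, exists j, position tm.1 x ->
    position (reply r tm.1 (seq_code [:: j; tm.2])) x.
  move=> [t m]; have [tx|] := pselect (position t x); last by exists 0%N.
  have /not_andP [//|/existsNP [j /contrapT jx]] := nesc t m.
  by exists j.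
(* [h] first copies [s]; then at even offsets it plays a ball found by [g] with the next digit of
   [y], and at odd offsets it follows [r]. *)
pose h (t : seq nat) := let k := (size t - size s)%N in
  if (size t < size s)%N then nth 0%N s (size t)
  else if odd k then r t else seq_code [:: g (t, y k./2); y k./2].
have [a aP] := strategy_run h.
have as_ : mkseq a (size s) = s.
  apply: (@eq_from_nth _ 0%N); rewrite size_mkseq // => i is_.
  by rewrite nth_mkseq // aP /h size_mkseq is_.
have ae k : a (size s + k.*2)%N =
    seq_code [:: g (mkseq a (size s + k.*2), y k); y k].
  by rewrite aP /h size_mkseq ltnNge leq_addr /= addKn odd_double doubleK.
have ao k : a (size s + k.*2).+1 = r (mkseq a (size s + k.*2).+1).
  rewrite [LHS]aP /h size_mkseq ltnNge -addnS leq_addr /= addKn /=.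
  by rewrite odd_double.
exists a; split => // [k|n]; first by rewrite ae /coord seq_codeK.
(* Positions decrease, so it is enough to treat the even offsets. *)
suff H k : position (mkseq a (size s + k.*2)) x.
  apply: position_mkseq_sub (H n); rewrite -addnn addnA; exact: leq_addl.
elim: k => [|k IHk]; first by rewrite addn0 as_.
rewrite doubleS !addnS mkseqS ao mkseqS ae.
exact: (gP (mkseq a (size s + k.*2)%N, y k)).
Qed.

Lemma meager_escape r : meager (\bigcup_(p : seq nat * nat) escape r p.1 p.2).
Proof.
by apply: meager_bigcup => p; apply: nowhere_dense_meager; exact: nowhere_dense_escape.
Qed.

(** A point that never escapes is the outcome of a run following the winning strategy. If I wins,
    such points of its first ball lie in [A]; if II wins, none lies in both [A] and [O], as I could
    play the digits of a witness. *)
Lemma unfolded_banach_mazur (B : set (Y * baire)) :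
  (forall f : baire -> Y * baire, continuous f -> determined (f @^-1` B)) ->
  let A := [set x | exists g, B (x, g)] in
  meager (A `&` O) \/
  exists U, [/\ open U, U !=set0, U `<=` O & meager (U `\` A)].
Proof.
move=> det A; have [f fc fP] := continuous_outcome.
(* Player I moves at even times, and the second components of these moves spell the witness. *)
pose w (a : baire) : baire := fun k => coord (a k.*2) 1.
have wc : continuous w.
  apply: (continuous_to_baire R) => k a.
  by apply: filterS (near_baire_coord R a k.*2) => b; rewrite /w => ->.
have [|[r rP]|[r rP]] := det (fun a => (f a, w a)).
- exact: continuous_pair.
- right; pose s := [:: r [::]]; have [os s0] := position_open s.
  exists (position s); split => //.
    exact: (@position_rcons_sub [::]).
  apply: meagerS (meager_escape r) => x [sx nAx].
  apply: contrapT => nesc.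
  have [|a [as_ _ ar ax]] := run_to_point (r := r) (fun=> 0%N) sx.
    by move=> t m tx; apply: nesc; exists (t, m).
  apply: nAx; exists (w a).
  rewrite (position_outcome_unique ax (fP a)).
  (* The prefix has length 1, so [ar] covers the even moves from 2 on, and move 0 is the prefix
     itself. *)
  apply: (rP a) => -[|k]; last by rewrite doubleS; exact: ar.
  by have /(congr1 (head 0%N)) := as_.
- left; apply: meagerS (meager_escape r) => x [[g Bxg] Ox].
  apply: contrapT => nesc.
  have [||a [_ ay ar ax]] := @run_to_point r [::] x g => //.
    by move=> t m tx; apply: nesc; exists (t, m).
  apply: (rP a) => [k|]; first exact: ar.
  rewrite /= -(position_outcome_unique ax (fP a)).
  suff -> : w a = g by [].
  by apply/funext => k; exact: ay.
Qed.

End BanachMazur.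

(** * The Baire property of projections *)

(** [W] collects the basic balls in which [A] is comeager, [Z] those in which it is meager. By the
    dichotomy their union is dense, and since there are countably many balls the exceptional parts
    add up to a meager set. *)
Lemma baire_property_projection (R : realType) (c : polish_choice R)
    (Y : polishType R) (B : set (Y * baire)) :
  (forall f : baire -> Y * baire, continuous f -> determined (f @^-1` B)) ->
  exists W, open W /\ meager ([set x | exists g, B (x, g)] `+` W).
Proof.
move=> det; set A := [set x | _].
have [d dC dK] := @polish_metrizable R Y.
have dichotomy U oU U0 := @unfolded_banach_mazur R c Y d dC dK U oU U0 B det.
pose N := basic_open c Y.
have oN k : open (N k) by exact: open_basic_open.
pose W := \bigcup_(k in [set k | meager (N k `\` A)]) N k.
pose Z := \bigcup_(k in [set k | meager (A `&` N k)]) N k.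
have oW : open W by apply: bigcup_open => k _.
have WZ : nowhere_dense (~` (W `|` Z)).
  apply: nowhere_denseP => U oU U0.
  suff [V [oV V0 VU VWZ]] : exists V, [/\ open V, V !=set0, V `<=` U & V `<=` W `|` Z].
    by exists V; split => //; apply/disjoints_subset; rewrite setCK.
  have [AU|[V [oV [x Vx] VU VA]]] := dichotomy U oU U0.
    have [x Ux] := U0.
    have [k kx kU] := basic_open_base c (open_nbhs_nbhs (conj oU Ux)).
    exists (N k); split => //; first by exists x.
    move=> y ky; right; exists k => //=.
    by apply: meagerS AU => z [Az /kU].
  have [k kx kV] := basic_open_base c (open_nbhs_nbhs (conj oV Vx)).
  exists (N k); split => //; first by exists x.
    exact: subset_trans VU.
  move=> y ky; left; exists k => //=.
  by apply: meagerS VA => z [/kV].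
exists W; split => //.
pose WA k := if `[< meager (N k `\` A) >] then N k `\` A else set0.
pose AZ k := if `[< meager (A `&` N k) >] then A `&` N k else set0.
have m0 := nowhere_dense_meager (@nowhere_dense0 Y).
have mWA : meager (\bigcup_k WA k).
  by apply: meager_bigcup => k; rewrite /WA; case: asboolP.
have mAZ : meager (\bigcup_k AZ k).
  by apply: meager_bigcup => k; rewrite /AZ; case: asboolP.
apply: meagerS (meagerU (meagerU mWA mAZ) (nowhere_dense_meager WZ)).
move=> x [[Ax nWx]|[[k /= kA kx] nAx]]; last first.
  by left; left; exists k => //; rewrite /WA; case: asboolP.
have [[k /= kA kx]|nZx] := pselect (Z x); last by right; case.
by left; right; exists k => //; rewrite /AZ; case: asboolP.
Qed.

(** * Sections of meager sets (Kuratowski-Ulam) *)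

(** The closure of a nowhere dense [F j] contains no nonempty open box, so the points over which it
    contains a given nonempty ball form a nowhere dense set [E (j, k)]. Over a point outside all of
    these, every section of every closure is nowhere dense. *)
Lemma meager_sections (R : realType) (c : polish_choice R) (Z : topologicalType)
    (X : polishType R) (M : set (Z * X)) :
  meager M -> comeager [set a | meager [set x | M (a, x)]].
Proof.
move=> [F [F0 MF]]; pose N := basic_open c X.
have oF j : open (~` closure (F j)) by exact/closed_openC/closed_closure.
pose E (p : nat * nat) := [set a | N p.2 !=set0 /\
   N p.2 `<=` [set x | closure (F p.1) (a, x)]].
have E0 p : nowhere_dense (E p).
  case: p => j k; apply: nowhere_denseP => U oU [a Ua].
  have [[x kx]|k0] := pselect (N k !=set0); last first.
    by exists U; split => //; [exists a|apply/seteqP; split=> // b [_ []]].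
  have [[b y] [[/= Ub ky] bF]] :
      exists p, (U `*` N k) p /\ ~ closure (F j) p.
    apply: contrapT => /forallNP H.
    suff : interior (closure (F j)) (a, x) by rewrite F0.
    exists (U, N k) => /=.
      by split; apply: open_nbhs_nbhs; split => //; exact: open_basic_open.
    by move=> p Up; apply: contrapT => nF; apply: (H p).
  (* With [y] fixed, all [b'] near [b] still miss the closure at [y]. *)
  exists (U `&` (fun b => (b, y)) @^-1` ~` closure (F j)); split.
  - apply: openI => //; have /continuousP : continuous (fun b : Z => (b, y)).
      by apply: continuous_pair => z; [exact: cvg_id|exact: cvg_cst].
    exact.
  - by exists b.
  - exact: subIsetl.
  - by apply/seteqP; split=> // b' [[_ /= nb'] [_ /(_ y ky)]].
apply: meagerS (meager_bigcup (fun p => nowhere_dense_meager (E0 p))) => a /= nMa.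
apply: contrapT => nE; apply: nMa.
apply: (@meagerS _ _ (\bigcup_j [set x | closure (F j) (a, x)])).
  by move=> x /MF [j _ Fx]; exists j => //; exact: subset_closure.
apply: meager_bigcup => j; apply: nowhere_dense_meager.
apply: nowhere_denseP => U oU [x Ux].
have [k kx kU] := basic_open_base c (open_nbhs_nbhs (conj oU Ux)).
have [y [ky nFy]] : exists y, N k y /\ ~ closure (F j) (a, y).
  apply: contrapT => /forallNP H; apply: nE; exists (j, k) => //; split => /=.
    by exists x.
  by move=> y ky; apply: contrapT => nF; apply: (H y).
exists (N k `&` (fun y => (a, y)) @^-1` ~` closure (F j)); split.
- apply: openI; first exact: open_basic_open.
  have /continuousP : continuous (fun z : X => (a, z)).
    by apply: continuous_pair => z; [exact: cvg_cst|exact: cvg_id].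
  exact.
- by exists y.
- by move=> z [/kU].
- by apply/seteqP; split=> // z [[_ nz]].
Qed.

(** * Continuous codes for the sections of an open set *)

(** The index [k] stands for a box, cylinder [s] times ball [t]. Digit [k] is [t] when the box lies
    in [W] and its cylinder contains [a], which a finite prefix of [a] decides. *)
Lemma continuous_open_code (R : realType) (c : polish_choice R) (X : polishType R)
    (W : set (baire * X)) :
  open W -> exists2 u : baire -> baire, continuous u &
    forall a, univ_U c X (u a) = [set x | W (a, x)].
Proof.
move=> oW; pose N := basic_open c X.
pose inW (s : seq nat) t := forall b x, mkseq b (size s) = s -> N t x -> W (b, x).
(* A ball of radius 0, hence empty: the default digit. *)
pose t0 := seq_code [:: 0; seq_code [:: 0; 0]]%N.
have N0 x : ~ N t0 x.
  rewrite /N /basic_open /= /qrat /coord !seq_codeK /= mul0r ltNge.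
  by rewrite (metric_ge0 (pdist_compatible _)).
pose u (a : baire) : baire := fun k =>
  if unpickle k is Some (s, t) then
    if (mkseq a (size s) == s) && `[< inW s t >] then t else t0
  else t0.
exists u.
  apply: (continuous_to_baire R) => k a; rewrite /u.
  case: unpickle => [[s t]|]; last exact: filterE.
  apply: (@filterS _ _ _ [set b : baire | mkseq b (size s) = mkseq a (size s)]).
    by move=> b /= ->.
  by apply/(nbhs_baireP R); exists (size s).
move=> a; apply/seteqP; split=> x /=.
  move=> [k]; rewrite /u; case: unpickle => [[s t]|]; last by move/N0.
  by case: ifP => [/andP[/eqP as_ /asboolP H]|_ /N0 //]; exact: H.
move: oW; rewrite openE => /[apply] -[[P Q] /= [Pa Qx] PQW].
have /(nbhs_baireP R) [n nP] := Pa; have [t tx tQ] := basic_open_base c Qx.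
exists (pickle (mkseq a n, t)); rewrite /u pickleK size_mkseq eqxx /=.
case: asboolP => // -[]; move=> b y; rewrite size_mkseq => /nP Pb /tQ Qy.
exact: PQW.
Qed.

Theorem proposition3 (R : realType) (c : polish_choice R)
  (n : nat) (hn : (1 <= n)%N)
  (hdet : (1 < n)%N -> Sigma1_determinacy n)
  (X : polishType R) :
  exists u : baire -> baire,
    continuous u /\
    comeager [set a : baire |
      meager (univ_G c n X a `+` univ_U c X (u a))].
Proof.
case: n hn hdet => [//|m] _ hdet.
have [B SB GE] := Sigma1_univ_G c m.+1 X.
(* The payoffs are continuous preimages of [B], so their complements stay at level [m]. *)
have detB (f : baire -> (baire * X) * baire) : continuous f -> determined (f @^-1` B).
  move=> cf; have : Sigma1 m (~` (f @^-1` B)).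
    by rewrite preimage_setC; exact: Sigma1_preimage cf SB.
  case: m hdet {SB GE} => [|m] hdet SfB.
    by apply: (closed_determined R); rewrite -openC.
  by apply: hdet => //; exact: Sigma1_setC.
have [W [oW GW]] := baire_property_projection c detB.
have [u cu uW] := continuous_open_code c oW.
exists u; split => //; rewrite -GE in GW.
by apply: meagerS (meager_sections c GW) => a; rewrite /= uW.
Qed.
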